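(* For each nonnegative integer $N$, $\mathbb{T}_N^{\breve{\mathrm{TY}},\breve{\phi}}=\mathbb{T}_N^{\breve{\mathcal{T}},\breve{u}}$; that is, the two rooted trees have the same vertices at every level, the same root, and the same edges.
   Context: Notation. $[m]=\{1,\dots,m\}$. $\binom{i}{j}$ denotes an ordered pair (not a binomial coefficient). $[\![P]\!]$ is $1$ if $P$ is true and $0$ otherwise. Generalized Farey intervals. For integers $m,n\ge 0$ let $G_{m,n}=\{0,\infty\}$ if $mn=0$ and $G_{m,n}=\{0,\infty\}\cup\{p/q: p\in[m],q\in[n]\}$ otherwise. $G^{\mathrm{int}}_{m,n}$ is the set of open intervals $(a,b)$ with $a<b$ consecutive elements of $G_{m,n}$ (in increasing order). $\mathcal{G}_{m,n}=\{((a,b),\binom{m}{n}):(a,b)\in G^{\mathrm{int}}_{m,n}\}$ and $\breve{\mathcal{G}}_k=\bigsqcup_{m,n\ge0,\,m+n=k}\mathcal{G}_{m,n}$. The map $\breve V_k:\breve{\mathcal{G}}_k\to\breve{\mathcal{G}}_{k-1}$ ($k\ge1$) is defined on $((a,b),\binom{m}{n})\in\mathcal{G}_{m,n}$, $m+n=k$, as follows. If $m=0$: $((0,\infty),\binom{0}{n})\mapsto((0,\infty),\binom{0}{n-1})$. If $n=0$: $((0,\infty),\binom{m}{0})\mapsto((0,\infty),\binom{m-1}{0})$. If $mn\ge1$, exactly one of the following four cases occurs, and $$((a,b),\tbinom{m}{n})\mapsto\begin{cases}((a,b),\binom{m-1}{n})& b<\frac mn,\\ ((a,\min\{c\in G_{m-1,n}:a<c\}),\binom{m-1}{n})&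 b=\frac mn,\\ ((\max\{c\in G_{m,n-1}:c<b\},b),\binom{m}{n-1})& a=\frac mn,\\ ((a,b),\binom{m}{n-1})& a>\frac mn.\end{cases}$$ This map is known to be well defined and surjective. Terminal pairs of difference equation type. For $m,n\ge1$, $\mathcal{E}^{1,\mathrm{in}}_{m,n}$ is the set of injections $f:([m]\times\{1\})\cup(\{1\}\times[n])\to[mn]$ with $f(1,1)=1$ such that $f(i+1,1)-f(i,1)=\sum_{t\in[n]}[\![f(1,t)\le f(i+1,1)]\!]$ for all $i\in[m-1]$ and $f(1,j+1)-f(1,j)=\sum_{s\in[m]}[\![f(s,1)\le f(1,j+1)]\!]$ for all $j\in[n-1]$. Let $\mathcal{T}^{1,\mathrm{in}}_{m,n}=\{(f(m,1),f(1,n),\binom{m}{n}):f\in\mathcal{E}^{1,\mathrm{in}}_{m,n}\}$ and $\breve{\mathcal{T}}_k=\bigsqcup_{m,n\ge1,\,m+n=k}\mathcal{T}^{1,\mathrm{in}}_{m,n}$ for $k\ge2$. For $k\ge3$ the map $\breve u_k:\breve{\mathcal{T}}_k\to\breve{\mathcal{T}}_{k-1}$ sends $(s,t,\binom{m}{n})$ to $(s-n,t,\binom{m-1}{n})$ if $s>t$ and to $(s,t-m,\binom{m}{n-1})$ if $s<t$ (known to be well defined and surjective). Young terminal pairs. For $m,n\ge1$ and real $\xi>0$ let $\tau^{m,n}_{1,\xi}:[m]\times[n]\to[mn]$, $\tau^{m,n}_{1,\xi}(i,j)=\sum_{s\in[m]}\sum_{t\in[n]}[\![s+t\xi\le i+j\xi]\!]$.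 $\mathrm{Y}_{m,n}$ is the set of those $\tau^{m,n}_{1,\xi}$ ($\xi>0$) that are injective. $\mathrm{TY}_{m,n}=\{(\theta(m,1),\theta(1,n),\binom{m}{n}):\theta\in\mathrm{Y}_{m,n}\}$ and $\breve{\mathrm{TY}}_k=\bigsqcup_{m,n\ge1,\,m+n=k}\mathrm{TY}_{m,n}$ for $k\ge 2$. For $k\ge2$, the map $\breve{\mathsf{ST}}_{k-1}:\breve{\mathcal{G}}_{k-2}\to\breve{\mathrm{TY}}_k$ sends $((a,b),\binom{m-1}{n-1})$ (with $m,n\ge1$, $m+n=k$) to $(\tau^{m,n}_{1,\xi}(m,1),\tau^{m,n}_{1,\xi}(1,n),\binom{m}{n})$ for any $\xi\in(a,b)$ (the value does not depend on the choice of $\xi$; this map is known to be a well-defined bijection). For $k\ge2$, $\breve\phi_{k+1}:=\breve{\mathsf{ST}}_{k-1}\circ\breve V_{k-1}\circ\breve{\mathsf{ST}}_k^{-1}:\breve{\mathrm{TY}}_{k+1}\to\breve{\mathrm{TY}}_k$. Trees. $\mathbb{T}_N^{\breve{\mathcal{T}},\breve u}$ is the rooted tree whose set of level $k$ vertices is $\breve{\mathcal{T}}_{k+2}$ ($0\le k\le N$), with root $(1,1,\binom{1}{1})$, where for $k<k'$ the vertices $v\in\breve{\mathcal{T}}_{k+2}$, $v'\in\breve{\mathcal{T}}_{k'+2}$ are adjacent iff $k'=k+1$ and $\breve u_{k'+2}(v')=v$. $\mathbb{T}_N^{\breve{\mathrm{TY}},\breve\phi}$ is the rooted tree whose set of level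 $k$ vertices is $\breve{\mathrm{TY}}_{k+2}$ ($0\le k\le N$), with root $(1,1,\binom{1}{1})$, where for $k<k'$ the vertices $v\in\breve{\mathrm{TY}}_{k+2}$, $v'\in\breve{\mathrm{TY}}_{k'+2}$ are adjacent iff $k'=k+1$ and $\breve\phi_{k'+2}(v')=v$. *)

(* Defs.v *)
From mathcomp Require Import all_boot all_order all_algebra.
From mathcomp Require Import boolp classical_sets functions.
From mathcomp Require Import reals constructive_ereal.

Set Implicit Arguments.
Unset Strict Implicit.
Unset Printing Implicit Defensive.

Import Order.TTheory GRing.Theory Num.Theory.

Local Open Scope classical_set_scope.

Definition brack (m : nat) : set nat := [set i | 1 <= i <= m].

(* A function on a subset of nat * nat is represented by a function on the
   whole of nat * nat, only the values on that subset being relevant.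
   Likewise the maps V, u, ST and phi below are total functions, only the
   values on the domains GG k, TT k, GG k and TY k being relevant. *)

(* (s, t, (m, n)); the component (m, n) makes the unions over m + n = k
   disjoint. *)
Definition vertex : Type := (nat * nat) * (nat * nat).

Section Farey.
Variable R : realType.
Local Open Scope ereal_scope.

(* The iterated list is empty when m * n = 0. *)
Definition G (m n : nat) : seq (\bar R) :=
  [:: 0, +oo & [seq (p%:R / q%:R)%:E | p <- iota 1 m, q <- iota 1 n]].

Definition Gint (m n : nat) : set (\bar R * \bar R) :=
  [set I | [/\ I.1 \in G m n, I.2 \in G m n, I.1 < I.2 &
             forall c, c \in G m n -> ~ (I.1 < c /\ c < I.2)]].

Definition Gvertex : Type := ((\bar R * \bar R) * (nat * nat))%type.

Definition GG (k : nat) : set Gvertex :=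
  [set x | (x.2.1 + x.2.2)%N = k /\ Gint x.2.1 x.2.2 x.1].

(* min {c in G m n : a < c}, for a < +oo: the neutral element +oo of the
   minimum belongs to this set. *)
Definition Gnext (m n : nat) (a : \bar R) : \bar R :=
  \big[Order.min/+oo]_(c <- G m n | a < c) c.

(* max {c in G m n : c < b}, for 0 < b: the neutral element 0 of the
   maximum belongs to this set. *)
Definition Gprev (m n : nat) (b : \bar R) : \bar R :=
  \big[Order.max/0]_(c <- G m n | c < b) c.

(* On GG k with m * n >= 1, the last branch is the case m / n < a. *)
Definition V (x : Gvertex) : Gvertex :=
  let: ((a, b), (m, n)) := x in
  let r : \bar R := (m%:R / n%:R)%:E in
  if m == 0%N then ((0, +oo), (0%N, n.-1))
  else if n == 0%N then ((0, +oo), (m.-1, 0%N))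
  else if b < r then ((a, b), (m.-1, n))
  else if b == r then ((a, Gnext m.-1 n a), (m.-1, n))
  else if a == r then ((Gprev m n.-1 b, b), (m, n.-1))
  else ((a, b), (m, n.-1)).

End Farey.

Section DifferenceEquations.

Definition hook (m n : nat) : set (nat * nat) :=
  (brack m `*` [set 1]) `|` ([set 1] `*` brack n).

Definition EE (m n : nat) : set (nat * nat -> nat) :=
  [set f | [/\ set_fun (hook m n) (brack (m * n)) f,
    set_inj (hook m n) f,
    f (1, 1) = 1,
    forall i, brack m.-1 i ->
      f (i.+1, 1) = f (i, 1) + \sum_(1 <= t < n.+1) (f (1, t) <= f (i.+1, 1)) &
    forall j, brack n.-1 j ->
      f (1, j.+1) = f (1, j) + \sum_(1 <= s < m.+1) (f (s, 1) <= f (1, j.+1))]].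

Definition Tin (m n : nat) : set vertex :=
  [set ((f (m, 1), f (1, n)), (m, n)) | f in EE m n].

Definition TT (k : nat) : set vertex :=
  [set v | exists m n, [/\ 1 <= m, 1 <= n, m + n = k & Tin m n v]].

(* On TT k with k >= 3, s and t are distinct and the subtractions are exact. *)
Definition u (v : vertex) : vertex :=
  let: ((s, t), (m, n)) := v in
  if t < s then ((s - n, t), (m.-1, n)) else ((s, t - m), (m, n.-1)).

End DifferenceEquations.

Section Young.
Variable R : realType.

Definition tau (m n : nat) (xi : R) (p : nat * nat) : nat :=
  \sum_(1 <= s < m.+1) \sum_(1 <= t < n.+1)
    (s%:R + t%:R * xi <= p.1%:R + p.2%:R * xi)%R.

Definition Y (m n : nat) : set (nat * nat -> nat) :=
  [set theta | exists xi : R, [/\ (0 < xi)%R, theta = tau m n xi &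
     set_inj (brack m `*` brack n) theta]].

Definition TYin (m n : nat) : set vertex :=
  [set ((theta (m, 1), theta (1, n)), (m, n)) | theta in Y m n].

Definition TY (k : nat) : set vertex :=
  [set v | exists m n, [/\ 1 <= m, 1 <= n, m + n = k & TYin m n v]].

Definition pick_in (a b : \bar R) : R :=
  xget 1%R [set xi : R | (a < xi%:E)%E /\ (xi%:E < b)%E].

(* An element of GG k carries the pair (m - 1, n - 1), where (m, n) is the pair
   of its image.  On GG k, xi is a real number in the nonempty interval (a, b);
   the value of ST does not depend on which one. *)
Definition ST (x : Gvertex R) : vertex :=
  let: ((a, b), (m', n')) := x in
  let m := m'.+1 in
  let n := n'.+1 in
  let xi := pick_in a b in
  ((tau m n xi (m, 1), tau m n xi (1, n)), (m, n)).

(* The inverse of the bijection ST : GG k -> TY k.+2 *)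
Definition STinv (k : nat) : vertex -> Gvertex R :=
  'pinv_(fun=> ((0%E, +oo%E), (0, 0))) (@GG R k) ST.

(* phi k : TY k -> TY k.-1, for k >= 3 *)
Definition phi (k : nat) : vertex -> vertex := ST \o @V R \o STinv k.-2.

End Young.

(* A rooted graph on X whose vertices are arranged in levels *)
Record leveled_graph (X : Type) := LeveledGraph {
  level : nat -> set X;
  root : X;
  adjacent : X -> X -> Prop }.

(* L k is the set of vertices of level k - 2, and par k maps L k to L k.-1. *)
Section Tree.
Variables (X : Type) (L : nat -> set X) (par : nat -> X -> X) (r : X) (N : nat).

Definition tree_level (k : nat) : set X := [set v | k <= N /\ L k.+2 v].

(* v has level k, v' has level k', and par maps v' to v *)
Definition tree_arc (v v' : X) : Prop :=
  exists k k', [/\ tree_level k v, tree_level k' v',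
    k' = k.+1 & par k'.+2 v' = v].

Definition tree : leveled_graph X :=
  LeveledGraph tree_level r (fun v v' => tree_arc v v' \/ tree_arc v' v).

End Tree.

Definition root11 : vertex := ((1, 1), (1, 1)).

Definition tree_T (N : nat) : leveled_graph vertex :=
  tree TT (fun=> u) root11 N.

Definition tree_TY (R : realType) (N : nat) : leveled_graph vertex :=
  tree (TY R) (phi R) root11 N.

(* Main.v *)
Require Import Defs.
From mathcomp Require Import all_boot all_order all_algebra.
From mathcomp Require Import boolp classical_sets functions.
From mathcomp Require Import reals constructive_ereal.
From mathcomp Require Import lra zify.

(* For generic xi > 0 the pair (tau (m, 1), tau (1, n)) depends only on the
   Farey cell of xi in G (m - 1) (n - 1).  If (n - 1) xi < m - 1, then row m
   of the m x n array lies above (1, n), so that tau (1, n) is unchanged and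
   tau (m, 1) drops by n when m is replaced by m - 1: this is the map u, and
   it is also V followed by relabelling; the opposite inequality is the same
   after xi |-> 1 / xi.  Terminal pairs of difference equation type are grown
   from (1, 1) by inverting u.  A step from (s, t) at (m, n) to (s + n, t) is
   allowed when t < s + n, and the cell of xi then meets the region
   (n - 1) xi < m: otherwise it lies above some p / q >= m / (n - 1), and
   counting points in each column gives s + n <= t. *)

Set Implicit Arguments.
Unset Strict Implicit.
Unset Printing Implicit Defensive.

Import Order.TTheory GRing.Theory Num.Theory.

Local Open Scope classical_set_scope.

(** * Sums of indicators *)

Lemma sum_nat_delta m i (F : nat -> nat) : 1 <= i <= m ->
  \sum_(1 <= s < m.+1) (s == i) * F s = F i.
Proof.
move=> im; rewrite (bigD1_seq i) ?iota_uniq ?mem_index_iota //=.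
by rewrite eqxx mul1n big1 ?addn0 // => s /negPf ->.
Qed.

Lemma sum_nat_delta2 m n i j : 1 <= i <= m -> 1 <= j <= n ->
  \sum_(1 <= s < m.+1) \sum_(1 <= t < n.+1) ((s == i) && (t == j)) = 1.
Proof.
move=> im jn; rewrite -[RHS](sum_nat_delta (fun=> 1) im).
apply: eq_bigr => s _; rewrite -[X in _ * X](sum_nat_delta (fun=> 1) jn).
by rewrite big_distrr /=; apply: eq_bigr => t _; rewrite muln1 mulnb.
Qed.

Lemma sum_leq_nat m k : \sum_(1 <= i < m.+1) (i <= k) = minn k m.
Proof.
elim: m => [|m IH]; first by rewrite big_geq // minn0.
by rewrite big_nat_recr //= IH; lia.
Qed.

(** * Ranks of array points by the weight i + j xi *)

Section Tau.
Variable R : realType.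
Implicit Types (xi x y : R) (m n i j s t q : nat).

(** A point of the array counts in its own rank but not in the rank of a point of smaller weight. *)
Lemma tau_le m n xi i j p : 1 <= i <= m -> 1 <= j <= n ->
  (tau m n xi (i, j) <= tau m n xi p) =
  (i%:R + j%:R * xi <= p.1%:R + p.2%:R * xi)%R.
Proof.
move=> im jn; apply/idP/idP => [|le_p]; last first.
  rewrite /tau /=; apply: leq_sum => s _; apply: leq_sum => t _.
  by case: (boolP (_ <= i%:R + _)%R) => // /le_trans ->.
apply: contraTT; rewrite -ltNge -ltnNge => lt_p.
rewrite -addn1 -(sum_nat_delta2 im jn) /tau -big_split /=.
apply: leq_sum => s _; rewrite -big_split; apply: leq_sum => t _ /=.
case: (boolP ((s == i) && _)) => [/andP[/eqP-> /eqP->]|_].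
  by rewrite lexx leNgt lt_p.
rewrite addn0; case: (boolP (_ <= p.1%:R + _)%R) => // /le_trans->//.
exact: ltW.
Qed.

Lemma tau_lt m n xi i j p : 1 <= i <= m -> 1 <= j <= n ->
  (tau m n xi p < tau m n xi (i, j)) =
  (p.1%:R + p.2%:R * xi < i%:R + j%:R * xi)%R.
Proof. by move=> im jn; rewrite ltnNge tau_le // ltNge. Qed.

Lemma tau11 m n xi : (0 < xi)%R -> 1 <= m -> 1 <= n -> tau m n xi (1, 1) = 1.
Proof.
move=> xi0 m0 n0; rewrite -[RHS](@sum_nat_delta2 m n 1 1) ?m0 ?n0 //.
apply: eq_big_nat => s /andP[s1 _]; apply: eq_big_nat => t /andP[t1 _].
congr nat_of_bool; apply/idP/andP => [/= h|[/eqP -> /eqP ->] //].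
have sR : (1 <= s%:R :> R)%R by rewrite ler1n.
have tR : (xi <= t%:R * xi)%R by rewrite ler_peMl ?ler1n ?ltW.
rewrite !eqn_leq s1 t1 !andbT -!(ler_nat R) -[(t%:R <= _)%R](ler_pM2r xi0).
by split; lra.
Qed.

Lemma tau_max m n xi p : tau m n xi p <= m * n.
Proof.
apply: (@leq_trans (\sum_(1 <= s < m.+1) \sum_(1 <= t < n.+1) 1)).
  by apply: leq_sum => s _; apply: leq_sum => t _; exact: leq_b1.
by rewrite !sum_nat_const_nat !subn1 muln1.
Qed.

(** Dividing all weights by [xi] transposes the array. *)
Lemma tau_swap m n xi i j : (0 < xi)%R ->
  tau m n xi (i, j) = tau n m xi^-1%R (j, i).
Proof.
move=> xi0; rewrite /tau exchange_big /=; apply: eq_bigr => t _.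
apply: eq_bigr => s _; rewrite -(ler_pM2r (_ : 0 < xi^-1)%R) ?invr_gt0 //.
by rewrite !mulrDl !mulfK ?gt_eqF // addrC [(i%:R / _ + _)%R]addrC.
Qed.

(* Translate by one the rows other than the first. *)
Lemma tau_shift m n xi i j : tau m.+1 n xi (i.+1, j) =
  \sum_(1 <= t < n.+1) (1%:R + t%:R * xi <= i.+1%:R + j%:R * xi)%R
  + tau m n xi (i, j).
Proof.
rewrite /tau big_ltn //=; congr (_ + _).
rewrite [LHS]big_add1 /=; apply: eq_bigr => s _; apply: eq_bigr => t _.
by rewrite -!natr1 -!addrA ![(1 + _)%R]addrC !addrA lerD2r.
Qed.

Lemma tau_trunc m n xi i j : (0 < xi)%R ->
  (i%:R + j%:R * xi < m.+1%:R + xi)%R ->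
  tau m.+1 n xi (i, j) = tau m n xi (i, j).
Proof.
move=> xi0 ij; rewrite /tau big_nat_recr //=.
rewrite [X in _ + X]big_nat [X in _ + X]big1 ?addn0 //.
move=> t /andP[t1 _]; rewrite leNgt (lt_le_trans ij) // lerD2l.
by rewrite ler_peMl ?ler1n // ltW.
Qed.

(** By [tau_shift], row 1 contributes the sum and the other rows the rank of [(i, 1)] in an array
    with one row fewer; the missing row lies above [(i, 1)]. *)
Lemma tau_diffeq m n xi i : (0 < xi)%R -> 1 <= i < m -> 1 <= n ->
  tau m n xi (i.+1, 1) = tau m n xi (i, 1) +
    \sum_(1 <= t < n.+1) (tau m n xi (1, t) <= tau m n xi (i.+1, 1)).
Proof.
case: m => [|m] xi0 /andP[i1 im] n1; first by lia.
rewrite {1}tau_shift addnC (@tau_trunc m n xi i).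
- congr (_ + _); apply: eq_big_nat => t tn; rewrite tau_le //.
- by [].
- by rewrite mul1r ltrD2r ltr_nat.
Qed.

(** The denominator is cleared so that [q = 0] is covered. *)
Definition same_cell m n x y := forall p q, p <= m -> q <= n ->
  (p%:R <= q%:R * x)%R = (p%:R <= q%:R * y)%R /\
  (q%:R * x <= p%:R)%R = (q%:R * y <= p%:R)%R.

(** Comparing two weights means comparing a difference of rows with [x] times a difference of
    columns. These are at most [m] and [n] in size; opposite signs are settled by positivity. *)
Lemma same_cell_tau m n x y i j : (0 < x)%R -> (0 < y)%R ->
  same_cell m n x y -> 1 <= i <= m.+1 -> 1 <= j <= n.+1 ->
  tau m.+1 n.+1 x (i, j) = tau m.+1 n.+1 y (i, j).
Proof.
move=> x0 y0 xy im jn; apply: eq_big_nat => s sm; apply: eq_big_nat => t tn.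
congr nat_of_bool => /=.
have cell_le (z : R) : i <= s -> t <= j ->
    (s%:R + t%:R * z <= i%:R + j%:R * z)%R = ((s - i)%:R <= (j - t)%:R * z)%R.
  by move=> si tj; rewrite !natrB // mulrBl lerBlDl addrA lerBrDr.
have cell_ge (z : R) : s <= i -> j <= t ->
    (s%:R + t%:R * z <= i%:R + j%:R * z)%R = ((t - j)%:R * z <= (i - s)%:R)%R.
  by move=> si tj; rewrite !natrB // mulrBl lerBlDr addrAC lerBrDl.
have lt_mul (z : R) a b : (0 < z)%R -> a < b -> (a%:R * z < b%:R * z)%R.
  by move=> z0 ab; rewrite ltr_pM2r // ltr_nat.
have [is_|si] := ltnP i s; have [jt|tj] := ltnP j t.
- have := lt_mul x _ _ x0 jt; have := lt_mul y _ _ y0 jt.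
  have : (i%:R < s%:R :> R)%R by rewrite ltr_nat.
  by move=> *; rewrite !leNgt; congr negb; rewrite !ltrD.
- rewrite !cell_le ?(ltnW is_) //.
  by have [||->] := @xy (s - i) (j - t); lia.
- rewrite !cell_ge ?(ltnW jt) //.
  by have [||_ ->] := @xy (i - s) (t - j); lia.
- by rewrite !lerD ?ler_nat // ler_wpM2r ?ler_nat ?ltW.
Qed.

Definition term m n xi : vertex :=
  ((tau m n xi (m, 1), tau m n xi (1, n)), (m, n)).

(** The hypothesis puts [(m.+1, 1)] above [(1, n.+1)]: all of row 1 lies below the former, all of
    row [m.+1] above the latter. *)
Lemma tau_stepL m n xi : (0 < xi)%R -> (n%:R * xi < m%:R)%R ->
  [/\ tau m.+1 n.+1 xi (m.+1, 1) = tau m n.+1 xi (m, 1) + n.+1,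
      tau m.+1 n.+1 xi (1, n.+1) = tau m n.+1 xi (1, n.+1) &
      tau m.+1 n.+1 xi (1, n.+1) < tau m.+1 n.+1 xi (m.+1, 1)].
Proof.
move=> xi0 h; have h' : (1 + n.+1%:R * xi < m.+1%:R + xi)%R.
  by rewrite -!natr1 mulrDl mul1r; lra.
split; last by rewrite tau_lt /= ?mul1r.
  rewrite tau_shift addnC; congr addn.
  transitivity (\sum_(1 <= t < n.+2) 1); last by rewrite sum_nat_const_nat; lia.
  apply: eq_big_nat => t /andP[_ tn]; rewrite mul1r.
  suff -> : (1 + t%:R * xi <= m.+1%:R + xi)%R by [].
  by apply: le_trans (ltW h'); rewrite lerD2l ler_pM2r // ler_nat.
by rewrite tau_trunc.
Qed.

Lemma u_termL m n xi : (0 < xi)%R -> (n%:R * xi < m%:R)%R ->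
  u (term m.+1 n.+1 xi) = term m n.+1 xi.
Proof.
move=> xi0 /(tau_stepL xi0)[e1 e2 lt]; rewrite /u /term lt /=.
by rewrite e1 e2 addnK.
Qed.

Definition swapv (v : vertex) : vertex :=
  ((v.1.2, v.1.1), (v.2.2, v.2.1)).

(** [u] sends a tie [s = t] to its second branch, which breaks the symmetry. *)
Lemma u_swapv v : v.1.1 != v.1.2 -> u (swapv v) = swapv (u v).
Proof. by case: v => -[s t] [m n] /=; case: ltngtP. Qed.

Lemma term_swap m n xi : (0 < xi)%R -> term m n xi = swapv (term n m xi^-1).
Proof. by move=> xi0; rewrite /term /swapv /= !(tau_swap _ _ _ _ xi0). Qed.

Lemma u_termR m n xi : (0 < xi)%R -> (m%:R < n%:R * xi)%R ->
  u (term m.+1 n.+1 xi) = term m.+1 n xi.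
Proof.
move=> xi0 h; have xi'0 : (0 < xi^-1)%R by rewrite invr_gt0.
have h' : (m%:R * xi^-1 < n%:R)%R by rewrite ltr_pdivrMr.
rewrite !(term_swap _ _ xi0) u_swapv ?u_termL //=.
by have [_ _ lt] := tau_stepL xi'0 h'; rewrite gtn_eqF.
Qed.

(** In a tie, a difference of rows is [x] times a difference of columns. Each such p / q is realised
    by [(p.+1, 1)] and [(1, q.+1)]. *)
Lemma tau_injP m n x : (0 < x)%R ->
  set_inj (brack m.+1 `*` brack n.+1) (tau m.+1 n.+1 x) <->
  forall p q, 1 <= p <= m -> 1 <= q <= n -> (p%:R != q%:R * x)%R.
Proof.
move=> x0; split=> [inj p q pm qn|gen].
  apply/negP => /eqP e.
  suff : (p.+1, 1) = (1, q.+1) by case; lia.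
  apply: inj; rewrite ?inE; [split; rewrite /brack /=; lia..|].
  apply/eqP; rewrite eqn_leq !tau_le /=; [|lia..].
  rewrite -(@natr1 _ p) -(@natr1 _ q) mulrDl -e !mul1r.
  by apply/andP; split; lra.
have lt i j i' j' : i <= m.+1 -> j' <= n.+1 -> 1 <= j -> 1 <= i' ->
    j < j' -> (i%:R + j%:R * x != i'%:R + j'%:R * x)%R.
  move=> im jn j1 i1 jj; apply/negP => /eqP e.
  have ji : ((j' - j)%:R * x = i%:R - i'%:R)%R.
    by rewrite natrB ?(ltnW jj) // mulrBl; lra.
  have ii : i' < i.
    rewrite -(ltr_nat R) -subr_gt0 -ji mulr_gt0 // ltr0n; lia.
  have /negP[] := gen (i - i') (j' - j) ltac:(lia) ltac:(lia).
  by rewrite ji natrB // ltnW.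
move=> [i j] [i' j'] /set_mem[/= im jn] /set_mem[/= i'm j'n] e.
rewrite /brack /= in im jn i'm j'n.
have {}e : (i%:R + j%:R * x = i'%:R + j'%:R * x)%R.
  by apply/eqP; rewrite eq_le -(@tau_le m.+1 n.+1 _ i j (i', j')) //
    -(@tau_le m.+1 n.+1 _ i' j' (i, j)) // e leqnn.
have [jj|jj|jj] := ltngtP j j'.
- by have /eqP[] : (i%:R + j%:R * x != i'%:R + j'%:R * x)%R by apply: lt; lia.
- by have /eqP[] : (i'%:R + j'%:R * x != i%:R + j%:R * x)%R by apply: lt; lia.
- by move: e; rewrite jj => /addIr/eqP; rewrite eqr_nat => /eqP ->.
Qed.

(** The obstruction to growth: as x > p / q >= m / n, no column has fewer points below [(1, n.+1)]
    than below [(m, 1)], and the gains add up. *)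
Lemma tau_far m n p q x : (0 < x)%R -> 1 <= p < m -> 1 <= q <= n ->
  (p%:R < q%:R * x)%R -> m * q <= p * n ->
  tau m n.+1 x (m, 1) + n.+1 <= tau m n.+1 x (1, n.+1).
Proof.
move=> x0 pm qn pq mqpn.
have qR : (0 < q%:R :> R)%R by rewrite ltr0n; lia.
have nR : (0 < n%:R :> R)%R by rewrite ltr0n; lia.
have mqR : (m%:R * q%:R <= p%:R * n%:R :> R)%R by rewrite -!natrM ler_nat.
have mnx : (m%:R < n%:R * x)%R.
  rewrite -(ltr_pM2r qR) (le_lt_trans mqR) // mulrC -mulrA ltr_pM2l //.
  by rewrite mulrC.
rewrite /tau [X in X + _ <= _]exchange_big [X in _ <= X]exchange_big /=.
have en : n.+1 = \sum_(1 <= t < n.+2) ((1 < t) + (t == q.+1) * 1).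
  rewrite big_split /= sum_nat_delta ?ltnS //; last by lia.
  rewrite big_ltn // big_nat (eq_bigr (fun=> 1)) => [|t /andP[-> _] //].
  by rewrite -big_nat sum_nat_const_nat; lia.
(* Column t gains one point when t > 1 and a second one when t = q + 1. *)
rewrite [X in _ + X <= _]en -big_split /=.
rewrite [X in X <= _]big_nat [X in _ <= X]big_nat; apply: leq_sum => t tn.
rewrite -(@natr1 R n) mulrDl !mul1r muln1.
have imp (P Q : bool) : (P -> Q) -> P <= Q by case: P Q => [] [] // /(_ isT).
have [t1|t1] := leqP t 1.
  have -> : t = 1 by lia.
  rewrite (_ : (1 == q.+1) = false) ?addn0; last by lia.
  rewrite [X in X <= _]big_nat [X in _ <= X]big_nat; apply: leq_sum => s sm.
  apply: imp => _; rewrite mul1r.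
  have : (s%:R <= m%:R :> R)%R by rewrite ler_nat; lia.
  lra.
have tx : (x + x <= t%:R * x)%R.
  by rewrite (_ : x + x = 2%:R * x)%R ?ler_pM2r ?ler_nat //; lra.
have tnx : (t%:R * x <= n%:R * x + x)%R.
  by rewrite -[X in (_ + X)%R]mul1r -mulrDl natr1 ler_pM2r // ler_nat; lia.
have [tq|tq] := eqVneq t q.+1.
  (* As q x > p, a point in row s of this column below [(m, 1)] has s + p < m. *)
  have A : \sum_(1 <= s < m.+1) (s%:R + t%:R * x <= m%:R + x)%R <= m - p - 1.
    apply: leq_trans (geq_minl _ m); rewrite -sum_leq_nat.
    apply: leq_sum => s _; apply: imp.
    rewrite tq -(@natr1 R q) mulrDl mul1r => h.
    have : (s%:R + p%:R < m%:R :> R)%R by lra.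
    by rewrite -natrD ltr_nat; lia.
  have B : m - p + 1 <=
      \sum_(1 <= s < m.+1) (s%:R + t%:R * x <= 1 + (n%:R * x + x))%R.
    have {1}-> : m - p + 1 = minn (m - p + 1) m by lia.
    rewrite -sum_leq_nat; apply: leq_sum => s _; apply: imp => h.
    have : (s%:R + p%:R <= m%:R + 1 :> R)%R.
      by rewrite natr1 -natrD ler_nat; lia.
    rewrite tq -(@natr1 R q) mulrDl mul1r => sp.
    (* That is, (n - q) x >= m - p, from q x > p and m q <= p n. *)
    have : (0 <= q%:R * ((n%:R - q%:R) * x - (m%:R - p%:R)))%R.
      have : (0 <= (n%:R - q%:R) * (q%:R * x - p%:R))%R.
        by rewrite mulr_ge0 ?subr_ge0 ?ler_nat ?(ltW pq) //; lia.
      by lra.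
    rewrite pmulr_rge0 // mulrBl => h'; lra.
  apply: leq_trans B; apply: leq_trans (leq_add A (leqnn _)) _; lia.
(* In the other columns, row s on the left is matched with row s + 1 on the right. The last row on
   the left fails and row 1 on the right counts. *)
case: m => [|m] in pm mqpn mqR mnx en *; first by lia.
rewrite big_nat_recr //= [X in _ <= X]big_ltn // [X in _ <= _ + X]big_add1 /=.
rewrite (_ : (m.+1%:R + t%:R * x <= m.+1%:R + x)%R = false); last first.
  by apply/negbTE; rewrite -ltNge; lra.
rewrite (_ : (1 + t%:R * x <= 1 + (n%:R * x + x))%R); last by rewrite lerD2l.
rewrite !addn0 addnC leq_add2l; apply: leq_sum => s _; apply: imp.
rewrite -(@natr1 R s); lra.
Qed.

End Tau.

(** * Young terminal pairs solve the difference equations *)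

Section TYsubT.
Variable R : realType.

Lemma TYin_swap m n v : TYin R m n v -> TYin R n m (swapv v).
Proof.
move=> [th [xi [xi0 -> inj]] <-]; exists (tau n m xi^-1%R).
  exists xi^-1%R; split; rewrite ?invr_gt0 // => -[j i] [j' i'].
  move=> /set_mem[/= jn im] /set_mem[/= j'n i'm].
  rewrite -!tau_swap // => /inj e.
  suff [-> ->] : (i, j) = (i', j') by [].
  by apply: e; rewrite inE.
by rewrite /swapv /= !(tau_swap _ _ _ _ xi0).
Qed.

Lemma TYin_sub m n v : 1 <= m -> 1 <= n -> TYin R m n v -> Tin m n v.
Proof.
move=> m1 n1 [th [xi [xi0 -> inj]] <-]; exists (tau m n xi) => //.
have hookS p : hook m n p -> (brack m `*` brack n) p.
  by case: p => i j [] [/=] => [im ->|-> jn]; split;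
    rewrite //= /brack /= ?m1 ?n1.
split.
- move=> [i j] /hookS [/= im jn]; rewrite /brack /= tau_max andbT.
  rewrite -(tau11 xi0 m1 n1) tau_le ?m1 ?n1 //=.
  case/andP: im => i1 _; case/andP: jn => j1 _.
  by rewrite lerD ?ler1n // ler_pM2r ?ler1n.
- by move=> p q /set_mem/hookS hp /set_mem/hookS hq; apply: inj; rewrite inE.
- exact: tau11.
- by move=> i im; rewrite -tau_diffeq //; move: im; rewrite /brack /=; lia.
(* The second equation is the first one for the transposed array. *)
- move=> j jn; have xi'0 : (0 < xi^-1)%R by rewrite invr_gt0.
  rewrite !(tau_swap _ _ _ _ xi0) [LHS]tau_diffeq //; last first.
    by move: jn; rewrite /brack /=; lia.
  by congr addn; apply: eq_bigr => s _; rewrite (tau_swap _ _ s _ xi0).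
Qed.
End TYsubT.

(** * Farey intervals and the conjugacy of [V] with [u] *)

Section Farey.
Variable R : realType.
Implicit Types (m n k p q : nat) (a b c : \bar R) (x y : R).

Lemma mem_G_frac m n p q : 1 <= p <= m -> 1 <= q <= n ->
  (p%:R / q%:R)%:E \in G R m n.
Proof.
move=> pm qn; rewrite /G !inE; apply/orP; right; apply/orP; right.
by apply/allpairsP; exists (p, q); rewrite !mem_iota; split => //=; lia.
Qed.

Lemma sub_G m n m' n' : m <= m' -> n <= n' -> {subset G R m n <= G R m' n'}.
Proof.
move=> mm nn c; rewrite inE => /orP[/eqP->|]; first by rewrite !inE eqxx.
rewrite inE => /orP[/eqP->|]; first by rewrite !inE eqxx orbT.
case/allpairsP => -[p q] /=; rewrite !mem_iota => -[pm qn ->].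
by apply: mem_G_frac; lia.
Qed.

Lemma G_ge0 m n c : c \in G R m n -> (0 <= c)%E.
Proof.
rewrite !inE => /or3P[/eqP->|/eqP->|/allpairsP[[p q] [_ _ ->]]].
- exact: lexx.
- exact: leey.
- by rewrite lee_fin divr_ge0.
Qed.

(** This clause of [Gint] passes to smaller [m] and [n], where an endpoint may leave [G]. *)
Definition gap m n a b := forall c, c \in G R m n -> ~ (a < c /\ c < b)%E.

Lemma sub_gap m n m' n' a b : m <= m' -> n <= n' ->
  gap m' n' a b -> gap m n a b.
Proof. by move=> mm nn h c /(sub_G mm nn); exact: h. Qed.

(** A fraction separating [x] from [y] would lie in the gap; positivity settles [p = 0] and
    [q = 0]. *)
Lemma gap_same_cell m n a b x y : (0 <= a)%E -> gap m n a b ->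
  (a < x%:E < b)%E -> (a < y%:E < b)%E -> same_cell m n x y.
Proof.
move=> a0 free.
have gt0 z : (a < z%:E < b)%E -> (0 < z)%R.
  by case/andP => az _; rewrite -lte_fin (le_lt_trans a0).
have sub z w p q : p <= m -> q <= n -> (a < z%:E < b)%E -> (a < w%:E < b)%E ->
    ((p%:R <= q%:R * z -> p%:R <= q%:R * w) /\
     (q%:R * z <= p%:R -> q%:R * w <= p%:R))%R.
  move=> pm qn zab wab; have z0 := gt0 z zab; have w0 := gt0 w wab.
  have [->|q0] := posnP q; first by rewrite !mul0r.
  have [->|p0] := posnP p.
    split=> [_|]; first by rewrite mulr_ge0 // ltW.
    by rewrite !pmulr_rle0 ?ltr0n // !leNgt z0.
  have qR : (0 < q%:R :> R)%R by rewrite ltr0n.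
  have /free fr : (p%:R / q%:R)%:E \in G R m n by rewrite mem_G_frac ?p0 ?q0.
  case/andP: zab => az zb; case/andP: wab => aw wb.
  split=> h; rewrite leNgt; apply/negP => h'; apply: fr; split.
  - by apply: lt_trans aw _; rewrite lte_fin ltr_pdivlMr // mulrC.
  - by apply: le_lt_trans zb; rewrite lee_fin ler_pdivrMr // mulrC.
  - by apply: lt_le_trans az _; rewrite lee_fin ler_pdivlMr // mulrC.
  - by apply: lt_trans wb; rewrite lte_fin ltr_pdivrMr // mulrC.
move=> xab yab p q pm qn.
have [h1 h2] := sub x y p q pm qn xab yab.
have [h3 h4] := sub y x p q pm qn yab xab.
by split; apply/idP/idP.
Qed.

(** Frees [ST] from the choice made by [pick_in]. *)
Lemma ST_term m n a b x : (0 <= a)%E -> gap m n a b -> (a < x%:E < b)%E ->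
  ST ((a, b), (m, n)) = term m.+1 n.+1 x.
Proof.
move=> a0 free xab; rewrite /ST /pick_in.
case: xgetP => [y _ /= [ay yb]|/(_ x) nx]; last first.
  by case/andP: xab => ax xb; case: nx.
have yab : (a < y%:E < b)%E by rewrite ay yb.
have gt0 z : (a < z%:E < b)%E -> (0 < z)%R.
  by case/andP => az _; rewrite -lte_fin (le_lt_trans a0).
have xy := gap_same_cell a0 free yab xab.
have h := same_cell_tau (gt0 _ yab) (gt0 _ xab) xy.
by rewrite /term !h ?ltnS ?leqnn.
Qed.

Lemma ereal_between a b : (0 <= a)%E -> (a < b)%E ->
  exists x, (a < x%:E < b)%E.
Proof.
case: a b => [a| |] [b| |] // _; last first.
  by exists (a + 1)%R; rewrite lte_fin ltry ltrDl ltr01.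
by rewrite lte_fin => ab; exists ((a + b) / 2)%R; rewrite !lte_fin !midf_lt.
Qed.

Lemma Gprev_lt m n x : (0 < x)%R -> (Gprev m n x%:E < x%:E)%E.
Proof. by move=> x0; apply: bigmax_lt. Qed.

Lemma lt_Gnext m n x : (x%:E < Gnext m n x%:E)%E.
Proof. by apply: lt_bigmin => //; exact: ltry. Qed.

Lemma gap_Gnext m n a : gap m n a (Gnext m n a).
Proof.
move=> c cG [ac]; apply/negP; rewrite -leNgt.
by apply: (ge_bigmin_seq _ _ _ _ cG).
Qed.

Lemma gap_Gprev m n b : gap m n (Gprev m n b) b.
Proof.
move=> c cG [+ cb]; apply/negP; rewrite -leNgt.
by apply: (@Order.TotalTheory.le_bigmax_seq _ _ _ _ _ c).
Qed.

Lemma Gnext_in m n a : Gnext m n a \in G R m n.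
Proof.
rewrite /Gnext big_seq_cond; elim/big_ind: _ => [|c c'|c /andP[]] //.
by rewrite minEle; case: ifP.
Qed.

Lemma Gprev_in m n b : Gprev m n b \in G R m n.
Proof.
rewrite /Gprev big_seq_cond; elim/big_ind: _ => [|c c'|c /andP[]] //.
  by rewrite !inE eqxx.
by rewrite maxEle; case: ifP.
Qed.

Lemma gap0 m n a b : m * n = 0 -> (0 <= a)%E -> gap m n a b.
Proof.
move=> mn0 a0 c; rewrite !inE => /or3P[/eqP->|/eqP->|/allpairsP[[p q]]].
- by case=> /(le_lt_trans a0); rewrite ltxx.
- by case=> _; rewrite ltNge leey.
- case=> /=; rewrite !mem_iota => pm qn _ _.
  by move/eqP: mn0; rewrite muln_eq0; lia.
Qed.

(** The interval of [V g] contains (a, b), so one [x] in (a, b) represents both sides. Its side of m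
    / n selects the branch of [V] and that of [u] alike. *)
Lemma ST_V k (g : Gvertex R) : GG k.+1 g -> ST (V g) = u (ST g).
Proof.
case: g => -[a b] [m n] [mnk [aG bG ab free]].
rewrite /= in mnk aG bG ab free.
have a0 := G_ge0 aG; have [x xab] := ereal_between a0 ab.
have x0 : (0 < x)%R.
  by case/andP: xab => ax _; rewrite -lte_fin (le_lt_trans a0).
rewrite (ST_term a0 free xab) /V.
have xoo : (0 < x%:E < +oo)%E by rewrite lte_fin x0 ltry.
case: m => [|m] in mnk free aG bG *.
  case: n => [//|n] in mnk free aG bG *; rewrite u_termR ?mulr_gt0 //.
  by apply: ST_term => //; exact: gap0.
case: n => [|n] in mnk free aG bG *.
  rewrite u_termL ?mul0r //.
  by apply: ST_term => //; apply: gap0; rewrite ?muln0.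
case/andP: (xab) => ax xb; rewrite -[m.+1 == 0]/false -[n.+1 == 0]/false.
have n0 : (0 < n.+1%:R :> R)%R by rewrite ltr0n.
have rG : (m.+1%:R / n.+1%:R)%:E \in G R m.+1 n.+1 by apply: mem_G_frac; lia.
have freeL := sub_gap (leqnSn m) (leqnn n.+1) free.
have freeR := sub_gap (leqnn m.+1) (leqnSn n) free.
have uL : (b <= (m.+1%:R / n.+1%:R)%:E)%E ->
    u (term m.+2 n.+2 x) = term m.+1 n.+2 x.
  move=> /(lt_le_trans xb); rewrite lte_fin ltr_pdivlMr // mulrC.
  by move=> /u_termL->.
have uR : ((m.+1%:R / n.+1%:R)%:E <= a)%E ->
    u (term m.+2 n.+2 x) = term m.+2 n.+1 x.
  move=> /le_lt_trans/(_ ax); rewrite lte_fin ltr_pdivrMr // mulrC.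
  by move=> /u_termR->.
case: ltgtP => [br|rb|br].
- by rewrite uL ?ltW //; exact: ST_term.
- have ra : ((m.+1%:R / n.+1%:R)%:E <= a)%E.
    by rewrite leNgt; apply/negP => ar; apply: (free _ rG).
  rewrite uR //; case: eqP => _; last exact: ST_term.
  apply: ST_term => //; first exact: (G_ge0 (Gprev_in _ _ _)).
    exact: gap_Gprev.
  (* An element of the smaller [G] strictly between [a] and [b] would break the gap, so the new
     endpoint is at most [a]. *)
  rewrite xb andbT; apply: le_lt_trans ax; rewrite leNgt; apply/negP => ap.
  apply: (free (Gprev m.+1 n b)); first exact: (sub_G _ _ (Gprev_in _ _ _)).
  by split=> //; apply: bigmax_lt => //; exact: lt_trans xb.
- rewrite uL ?br //; apply: ST_term => //; first exact: gap_Gnext.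
  rewrite ax /=; apply: lt_le_trans xb _; rewrite leNgt; apply/negP => nb.
  apply: (free (Gnext m n.+1 a)); first exact: (sub_G _ _ (Gnext_in _ _ _)).
  by split=> //; apply: lt_bigmin => //; exact: lt_trans ax (ltry _).
Qed.

(** Injectivity of the ranks keeps [x] out of [G], so its two neighbours in [G] bound a Farey
    interval around it. *)
Lemma ST_surj k v : TY R k.+2 v -> exists2 g, @GG R k g & ST g = v.
Proof.
case=> m [n [m1 n1 mnk [th [x [x0 -> inj]] <-]]].
case: m n m1 n1 mnk inj => [|m] [|n] // _ _ mnk inj.
have {inj}gen := (tau_injP m n x0).1 inj.
have xin : (Gprev m n x%:E < x%:E < Gnext m n x%:E)%E.
  by rewrite Gprev_lt // lt_Gnext.
have free : gap m n (Gprev m n x%:E) (Gnext m n x%:E).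
  move=> c cG [pc cn].
  have [cx|xc|cx] := ltgtP c x%:E.
  - exact: (gap_Gprev cG (conj pc cx)).
  - exact: (gap_Gnext cG (conj xc cn)).
  move: cG; rewrite cx inE => /orP[/eqP[] x00|].
    by rewrite x00 ltxx in x0.
  rewrite inE => /orP[/eqP //|/allpairsP[[p q]]].
  rewrite !mem_iota /= => -[pm qn].
  case=> xpq; have /eqP[] := gen p q ltac:(lia) ltac:(lia).
  by rewrite xpq mulrC divfK // pnatr_eq0; lia.
exists ((Gprev m n x%:E, Gnext m n x%:E), (m, n)).
  split=> /=; first by lia.
  split=> //; rewrite ?Gprev_in ?Gnext_in //=.
  by case/andP: xin; exact: lt_trans.
by rewrite (ST_term (G_ge0 (Gprev_in _ _ _)) free xin).
Qed.

(** By [ST_surj], [STinv] picks a genuine preimage of [v], to which [ST_V] applies. *)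
Lemma phiE k v : TY R k.+3 v -> phi R k.+3 v = u v.
Proof.
move=> /ST_surj[g gG gv]; rewrite /phi /= /STinv.
set d := (fun=> _).
have vim : (@ST R @` @GG R k.+1) v by exists g.
have pG : @GG R k.+1 ('pinv_d (@GG R k.+1) (@ST R) v).
  apply: (@surjpinv_image_sub _ _ d _ (@ST R @` @GG R k.+1)); last by exists v.
  exact: subset_refl.
by rewrite (ST_V pG) (@pinvK _ _ d _ (@ST R)) // inE.
Qed.

End Farey.

(** * Inverting a step of [u] on Young terminal pairs *)

Section Growth.
Variable R : realType.
Implicit Types (m n k p q s t : nat) (x y z : R).

(** Induction over the finitely many pairs: when p / q < z, [y] is raised at least to the midpoint
    of p / q and [z]. *)
Lemma approach_below m n z : (0 < z)%R -> exists2 y, (0 < y < z)%R &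
  forall p q, p <= m -> q <= n -> (p%:R < q%:R * z)%R -> (p%:R < q%:R * y)%R.
Proof.
move=> z0; pose pq := [seq (p, q) | p <- iota 0 m.+1, q <- iota 0 n.+1].
suff [y yz h] : exists2 y, (0 < y < z)%R &
    forall p q, (p, q) \in pq -> (p%:R < q%:R * z)%R -> (p%:R < q%:R * y)%R.
  exists y => // p q pm qn; apply: h; apply/allpairsP; exists (p, q).
  by rewrite !mem_iota; split=> //=; lia.
elim: pq => [|[p q] l [y /andP[y0 yz] IH]].
  by exists (z / 2)%R => //; apply/andP; split; lra.
have [pq|pq] := ltP (p%:R)%R (q%:R * z)%R; last first.
  exists y => [|p' q']; first by rewrite y0.
  rewrite inE => /predU1P[[-> ->]|]; last exact: IH.
  by rewrite ltNge pq.
have q0 : (0 < q%:R :> R)%R.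
  by rewrite ltr0n lt0n; apply: contraTneq pq => ->; rewrite mul0r -leNgt.
pose w := ((p%:R / q%:R + z) / 2)%R.
have [pw wz] : (p%:R / q%:R < w)%R /\ (w < z)%R.
  have pqz : (p%:R / q%:R < z)%R by rewrite ltr_pdivrMr // mulrC.
  by rewrite /w; split; lra.
exists (Num.max y w) => [|p' q']; first by rewrite lt_max gt_max y0 yz wz.
rewrite inE => /predU1P[[-> ->] _|/IH h /h ].
  by rewrite mulrC -ltr_pdivrMr // lt_max pw orbT.
by move=> /lt_le_trans -> //; rewrite ler_wpM2l // le_max lexx.
Qed.

(** The real [x] is lowered, within its cell, to some [y] with (n - 1) y < m, where [tau_stepL]
    applies. *)
Lemma TYin_growL m n s t : 1 <= m -> 1 <= n -> TYin R m n ((s, t), (m, n)) ->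
  t < s + n -> TYin R m.+1 n ((s + n, t), (m.+1, n)).
Proof.
case: m n => [|m] [|n] // _ _ [th [x [x0 -> inj]] [<- <-]] lt.
have gen := (tau_injP m n x0).1 inj.
(* The bound for [y]; if [n = 0], the condition n y < m + 1 is automatic. *)
pose z := if n == 0 then x else Num.min x (m.+1%:R / n%:R)%R.
have [z0 zx] : (0 < z)%R /\ (z <= x)%R.
  rewrite /z; case: posnP => // n0.
  by rewrite lt_min x0 divr_gt0 ?ltr0n // ge_min lexx.
have nz y : (y < z -> n%:R * y < m.+1%:R)%R.
  rewrite /z; case: posnP => [-> _|n0]; first by rewrite mul0r ltr0n.
  by rewrite lt_min ltr_pdivlMr ?ltr0n // mulrC => /andP[].
(* The hypothesis on [t] enters here: by [tau_far], no p / q < x with [p <= m] reaches (m + 1) /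
   n. *)
have xz p q : p <= m -> q <= n -> (p%:R < q%:R * x -> p%:R < q%:R * z)%R.
  move=> pm qn pqx; rewrite /z; case: posnP => [//|n0].
  have [q0|q0] := posnP q; first by move: pqx; rewrite q0 !mul0r ltNge ler0n.
  rewrite minr_pMr // lt_min pqx /= mulrA ltr_pdivlMr ?ltr0n // -!natrM ltr_nat.
  have [->|p0] := posnP p; first by rewrite mul0n muln_gt0 q0.
  rewrite ltnNge mulnC; apply: contraL lt => /(tau_far x0 _ _ pqx) h.
  by rewrite -leqNgt; apply: h; lia.
(* Numerators go up to [m.+1] so that [y] also avoids the new fractions of the larger array. *)
have [y /andP[y0 yz] yap] := approach_below m.+1 n z0.
have xy : same_cell m n x y.
  move=> p q pm qn.
  have [->|q0] := posnP q; first by rewrite !mul0r.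
  have [->|p0] := posnP p.
    rewrite !pmulr_rge0 ?ltr0n // !pmulr_rle0 ?ltr0n //.
    by rewrite (ltW x0) (ltW y0) !leNgt x0 y0.
  have neqx := gen p q ltac:(lia) ltac:(lia).
  have yx : (q%:R * y < q%:R * x)%R.
    by rewrite ltr_pM2l ?ltr0n // (lt_le_trans yz).
  have [pqx|pqx|pqx] := ltgtP (p%:R)%R (q%:R * x)%R.
  - have pqy := yap p q ltac:(lia) qn (xz p q pm qn pqx).
    by rewrite (ltW pqy) leNgt pqy.
  - have pqy := lt_trans yx pqx.
    by rewrite (ltW pqy) leNgt pqy.
  - by rewrite pqx eqxx in neqx.
have [e1 e2 _] := tau_stepL y0 (nz _ yz).
exists (tau m.+2 n.+1 y); last first.
  by rewrite e1 e2 !(same_cell_tau x0 y0 xy) ?leqnn.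
exists y; split=> //; apply/tau_injP => // p q pm qn; apply/negP => /eqP pqy.
have := yap p q ltac:(lia) ltac:(lia).
by rewrite pqy ltr_pM2l ?ltr0n ?ltxx ?yz => [/(_ isT)|]//; lia.
Qed.

End Growth.

(** * Peeling solutions of the difference equations *)

Section TsubTY.
Variable R : realType.
Implicit Types (m n i j k s t : nat) (f : nat * nat -> nat).

(* EE without the bound f <= m * n, which follows from the other conditions. *)
Definition hook_eq m n f := [/\ set_inj (hook m n) f, f (1, 1) = 1,
  forall i, 1 <= i < m -> f (i.+1, 1) =
    f (i, 1) + \sum_(1 <= t < n.+1) (f (1, t) <= f (i.+1, 1)) &
  forall j, 1 <= j < n -> f (1, j.+1) =
    f (1, j) + \sum_(1 <= s < m.+1) (f (s, 1) <= f (1, j.+1))].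

Definition swap (p : nat * nat) := (p.2, p.1).

Lemma hook_eq_swap m n f : hook_eq m n f -> hook_eq n m (f \o swap).
Proof.
case=> inj f11 fL fR; split=> // p q /set_mem hp /set_mem hq /inj e.
have hS a : hook n m a -> swap a \in hook m n.
  by case: a => i j; rewrite inE => -[[/= ? ->]|[/= -> ?]]; [right|left].
by have := e (hS _ hp) (hS _ hq); case: p q {hp hq e} => ? ? [? ?] /= [-> ->].
Qed.

Lemma hook_eq_le m n f j : hook_eq m n f -> 1 <= j <= n -> f (1, j) <= f (1, n).
Proof.
case=> _ _ _ fR /andP[j1 jn].
elim: n jn fR => [|n IH]; first by case: j j1.
rewrite leq_eqVlt => /predU1P[<- //|jn] fR.
suff: f (1, n) <= f (1, n.+1).
  by apply: leq_trans; apply: IH => // i ij; apply: fR; lia.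
by rewrite fR ?leq_addr //; lia.
Qed.

(** Values grow along an arm, so every [f (1, t)] is below [f (m.+1, 1)]: the last increment is [n],
    and [(m.+1, 1)] adds nothing to the equations of the other arm. *)
Lemma hook_eq_shrink m n f : 1 <= m -> hook_eq m.+1 n f ->
  f (1, n) < f (m.+1, 1) -> hook_eq m n f /\ f (m.+1, 1) = f (m, 1) + n.
Proof.
move=> m1 hf lt; have le j := @hook_eq_le _ _ _ j hf.
case: hf => inj f11 fL fR; split; first split=> //.
- have hS a : hook m n a -> hook m.+1 n a.
    case=> -[h1 h2]; [left|right]; split=> //.
    by move: h1; rewrite /brack /=; lia.
  by move=> p q /set_mem hp /set_mem hq; apply: inj; rewrite inE; exact: hS.
- by move=> i im; apply: fL; lia.
- move=> j jn; rewrite {1}fR // big_nat_recr //=.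
  rewrite (_ : (f (m.+1, 1) <= f (1, j.+1)) = false) ?addn0 //.
  by apply/negbTE; rewrite -ltnNge (leq_ltn_trans _ lt) // le; lia.
rewrite fL ?m1 ?leqnn //; congr addn.
transitivity (\sum_(1 <= t < n.+1) 1); last by rewrite sum_nat_const_nat; lia.
apply: eq_big_nat => t tn; rewrite (leq_trans (le t _)) ?(ltnW lt) //; lia.
Qed.

(** The larger terminal value is peeled off and restored by [TYin_growL], after a transposition if
    it is [f (1, n)]. Equal values force m = n = 1 by injectivity. *)
Lemma hook_eq_TYin k m n f : m + n = k -> 1 <= m -> 1 <= n -> hook_eq m n f ->
  TYin R m n ((f (m, 1), f (1, n)), (m, n)).
Proof.
elim: k m n f => [|k IH] m n f; first by lia.
have IHL m' n' g : m' + n' = k.+1 -> 1 <= m' -> 1 <= n' -> hook_eq m' n' g ->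
    g (1, n') < g (m', 1) -> TYin R m' n' ((g (m', 1), g (1, n')), (m', n')).
  case: m' => [|m'] // mnk _ n0 hg lt; have g_le := hook_eq_le hg.
  have [m0|m0] := posnP m'.
    by move: lt; rewrite m0 ltnNge g_le.
  have [hg' e] := hook_eq_shrink m0 hg lt.
  rewrite e; apply: TYin_growL => //; last by rewrite -e.
  by apply: IH => //; lia.
move=> mnk m0 n0 hf; have [lt|lt|e] := ltngtP (f (1, n)) (f (m, 1)).
- exact: IHL.
- apply: (@TYin_swap R n m ((_, _), (_, _))).
  by apply: (IHL _ _ _ _ _ _ (hook_eq_swap hf)) => //; lia.
have [inj f11 _ _] := hf.
have [n1 m1] : (1, n) = (m, 1).
  by apply: inj => //; rewrite inE; [right|left]; split=> //;
    rewrite /brack /=; lia.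
rewrite -n1 m1 f11; exists (tau 1 1 (1%R : R)); last by rewrite tau11.
exists 1%R; split=> //; apply/tau_injP => // p q; lia.
Qed.

Lemma TYinE m n : 1 <= m -> 1 <= n -> TYin R m n = Tin m n.
Proof.
move=> m0 n0; apply/seteqP; split=> v; first exact: TYin_sub.
case=> f [_ inj f11 fL fR] <-; apply: hook_eq_TYin => //; split=> // i im.
  by apply: fL; rewrite /brack /=; lia.
by apply: fR; rewrite /brack /=; lia.
Qed.

Lemma TYE k : TY R k = TT k.
Proof.
apply/seteqP; split=> v [m [n [m0 n0 mnk vmn]]]; exists m, n; split=> //.
  by rewrite -TYinE.
by rewrite TYinE.
Qed.

End TsubTY.

Theorem theorem1 (R : realType) (N : nat) : tree_TY R N = tree_T N.
Proof.
have lvl : tree_level (TY R) N = tree_level TT N.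
  by apply/funext => k; rewrite /tree_level TYE.
(* A child has level [k.+1], so it lies in [TY R k.+3], where [phi] is [u]. *)
have arc v w : tree_arc (TY R) (phi R) N v w <-> tree_arc TT (fun=> u) N v w.
  rewrite /tree_arc lvl.
  by split=> -[k [k' [vk wk ek e]]]; exists k, k'; split=> //;
    rewrite -e ek phiE // TYE -ek; case: wk.
rewrite /tree_TY /tree_T /tree lvl; congr LeveledGraph.
apply/funext => v; apply/funext => w; apply/propext.
by rewrite (propext (arc v w)) (propext (arc w v)).
Qed.
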